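(* Let $\lambda\geq 2$. Suppose there exists an $(n,m,k,\lambda)$-strong external difference family (in some additive abelian group of order $n$) with $m\geq 3$ and $k\geq \lambda+1$. Then \[ \frac{\lambda(k-1)(m-2)}{(\lambda-1)k(m-1)}\leq 1. \]
   Context: For disjoint subsets $A,B$ of an additive abelian group $G$, let $\mathcal{D}(A,B)$ denote the multiset $\{x-y : x\in A,\ y\in B\}$. An $(n,m,k,\lambda)$-strong external difference family (SEDF) in an additive abelian group $G$ of order $n$ is a set of $m\geq 2$ pairwise disjoint $k$-subsets $A_1,\dots,A_m$ of $G$ such that for every $i$, $1\le i\le m$, the multiset union $\bigcup_{j\neq i}\mathcal{D}(A_i,A_j)$ equals $\lambda(G\setminus\{0\})$, i.e. contains every nonzero element of $G$ exactly $\lambda$ times. *)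

(* Defs.v *)
From mathcomp Require Export all_boot all_order all_algebra.
From mathcomp Require Export finmap multiset.

Set Implicit Arguments.
Unset Strict Implicit.
Unset Printing Implicit Defensive.

Import GRing.Theory.
Local Open Scope ring_scope.
Local Open Scope mset_scope.

Definition diff_mset (G : finZmodType) (A B : {set G}) : {mset G} :=
  seq_mset [seq x - y | x <- enum A, y <- enum B].

(* The multiset l(G \ {0}): every nonzero element of G with multiplicity
   exactly l, and 0 with multiplicity 0. *)
Definition nonzero_mset (G : finZmodType) (l : nat) : {mset G} :=
  \big[msetD/mset0]_(x in [set~ (0 : G)]) msetn l x.

(* "Multiset union" adds multiplicities, so it is msetD (not msetU, which takes
   their maximum). The sets A_j with j <> i are the members of S :\ A_i. *)
Record is_SEDF (G : finZmodType) (n m k l : nat) (S : {set {set G}}) : Prop :=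
  IsSEDF {
    SEDF_order : #|G| = n;
    SEDF_ge2 : (2 <= m)%N;
    SEDF_card : #|S| = m;
    SEDF_disjoint : trivIset S;
    SEDF_block : forall A, A \in S -> #|A| = k;
    SEDF_diff : forall A, A \in S ->
      \big[msetD/mset0]_(B in S :\ A) diff_mset A B = nonzero_mset G l
  }.

(* Main.v *)
Require Import Defs.
From mathcomp Require Import zify.

Set Implicit Arguments.
Unset Strict Implicit.
Unset Printing Implicit Defensive.

Import GRing.Theory Num.Theory.
Local Open Scope ring_scope.

(** Fix a block [A] and let [B] be the union of the other blocks.  Double count
    the quadruples [(x, x', y, y')] with [x <> x'] in [A], [y, y'] in [B] and
    [x - y = x' - y'].  Each difference between [A] and [B] occurs exactly [l]
    times, so there are [k * #|B| * (l - 1)] of them.  On the other hand the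
    condition reads [x - x' = y - y'], and every nonzero element is a difference
    of two elements of [B] lying in distinct blocks exactly
    [l * (m - 1) - l = l * (m - 2)] times, so there are at least
    [k * (k - 1) * l * (m - 2)] of them. *)

Definition diff_count (G : finZmodType) (A B : {set G}) (g : G) : nat :=
  (\sum_(x in A) \sum_(y in B) (x - y == g)%R)%N.

Lemma diff_msetE (G : finZmodType) (A B : {set G}) (g : G) :
  diff_mset A B g = diff_count A B g.
Proof.
rewrite mset_seqE count_flatten -map_comp sumnE big_map big_enum.
apply: eq_bigr => x _ /=.
by rewrite count_map -sum1_count big_mkcond big_enum; apply: eq_bigr => y _ /=; case: eqP.
Qed.

Lemma big_msetDE (K : choiceType) (I : finType) (P : pred I)
    (F : I -> {mset K}%mset) (a : K) :
  (\big[msetD/mset0]_(i | P i) F i)%mset a = (\sum_(i | P i) F i a)%N.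
Proof.
by apply: (big_morph (fun M : {mset K}%mset => M a)) => [M N|];
  rewrite ?msetE2 ?mset0E.
Qed.

Lemma nonzero_msetE (G : finZmodType) (l : nat) (g : G) :
  nonzero_mset G l g = if g == 0 then 0%N else l.
Proof.
rewrite big_msetDE; case: eqP => [->|/eqP g0].
  by apply: big1 => x; rewrite !inE msetnE eq_sym => /negPf ->.
rewrite (bigD1 g) ?inE //= msetnE eqxx big1 ?addn0 // => x /andP[_].
by rewrite msetnE eq_sym => /negPf ->.
Qed.

Lemma diff_countC (G : finZmodType) (A B : {set G}) (g : G) :
  diff_count A B g = diff_count B A (- g).
Proof.
rewrite /diff_count exchange_big; apply: eq_bigr => y _; apply: eq_bigr => x _.
by rewrite -(inj_eq oppr_inj) opprB.
Qed.

Lemma diff_count_coverl (G : finZmodType) (S : {set {set G}}) (B : {set G})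
    (g : G) : trivIset S ->
  diff_count (cover S) B g = (\sum_(A in S) diff_count A B g)%N.
Proof. by move=> tS; rewrite /diff_count big_trivIset. Qed.

Lemma diff_count_coverr (G : finZmodType) (S : {set {set G}}) (A : {set G})
    (g : G) : trivIset S ->
  diff_count A (cover S) g = (\sum_(B in S) diff_count A B g)%N.
Proof.
move=> tS; rewrite diff_countC diff_count_coverl //.
by apply: eq_bigr => B _; rewrite diff_countC opprK.
Qed.

(** Both sides count the quadruples [(x, x', y, y')] with [x - y = x' - y']. Those with [x = x']
    force [y = y'] and give [#|A| * #|B|]; the others are sorted by [x - x']. *)
Lemma diff_count_quadruples (G : finZmodType) (A B : {set G}) :
  (\sum_(x in A) \sum_(y in B) diff_count A B (x - y)%R
   = #|A| * #|B| + \sum_(x in A) \sum_(x' in A :\ x) diff_count B B (x - x')%R)%N.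
Proof.
rewrite -sum_nat_const -big_split /=; apply: eq_bigr => x xA.
under eq_bigr => y _ do rewrite /diff_count (big_setD1 x) //=.
rewrite big_split /=; congr (_ + _)%N.
  rewrite -sum1_card; apply: eq_bigr => y yB.
  rewrite (big_setD1 y) //= eqxx big1 ?addn0 // => z; rewrite !inE => /andP[zy _].
  by rewrite (inj_eq (addrI _)) (inj_eq oppr_inj) (negPf zy).
rewrite exchange_big; apply: eq_bigr => x' _.
apply: eq_bigr => y _; apply: eq_bigr => y' _; congr (nat_of_bool _).
(* Adding [y - x'] to both sides turns [x' - y' = x - y] into [y - y' = x - x']. *)
by rewrite -(inj_eq (addIr (y - x'))) (addrC (x' - y')) !subrKA.
Qed.

Section SEDF.

Variables (G : finZmodType) (n m k l : nat) (S : {set {set G}}).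
Hypothesis sedf : is_SEDF n m k l S.

Lemma SEDF_diff_count (A : {set G}) (g : G) : A \in S -> g != 0 ->
  (\sum_(B in S :\ A) diff_count A B g = l)%N.
Proof.
move=> AS g0; have /(congr1 (fun M : {mset G}%mset => M g)) := SEDF_diff sedf AS.
rewrite big_msetDE nonzero_msetE (negPf g0) => <-.
by apply: eq_bigr => B _; rewrite diff_msetE.
Qed.

Lemma SEDF_trivIsetD1 (A : {set G}) : trivIset (S :\ A).
Proof. exact: trivIsetS (subD1set _ _) (SEDF_disjoint sedf). Qed.

Lemma SEDF_card_others (A : {set G}) : A \in S ->
  #|cover (S :\ A)| = ((m - 1) * k)%N.
Proof.
move=> AS; rewrite -(eqP (SEDF_trivIsetD1 A)).
rewrite (eq_bigr (fun=> k)) => [|B /setD1P[_ BS]]; last exact: SEDF_block sedf _ BS.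
by rewrite sum_nat_const -(SEDF_card sedf) (cardsD1 A S) AS addKn.
Qed.

Lemma SEDF_disjoint_others (A : {set G}) (x y : G) : A \in S ->
  x \in A -> y \in cover (S :\ A) -> x - y != 0.
Proof.
move=> AS xA /bigcupP[B /setD1P[BA BS] yB]; rewrite subr_eq0.
have /trivIsetP/(_ _ _ BS AS BA) dBA := SEDF_disjoint sedf.
by apply: contraTneq xA => ->; rewrite (disjointFr dBA).
Qed.

(** Each of the [m - 1] blocks [C] other than [A] yields [g] exactly [l] times as a difference to a
    different block. Of these [l * (m - 1)] occurrences, those ending in [A] number [l], by the
    condition on [A] at [- g]. *)
Lemma SEDF_diff_count_others (A : {set G}) (g : G) : A \in S -> g != 0 ->
  (l * (m - 2) <= diff_count (cover (S :\ A)) (cover (S :\ A)) g)%N.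
Proof.
move=> AS g0; have tSA := SEDF_trivIsetD1 A.
have cBA : diff_count (cover (S :\ A)) A g = l.
  by rewrite diff_countC diff_count_coverr // SEDF_diff_count ?oppr_eq0.
have cSA : #|S :\ A| = (m - 1)%N.
  by rewrite -(SEDF_card sedf) (cardsD1 A S) AS addKn.
suff : (l * (m - 1) <=
    diff_count (cover (S :\ A)) A g
    + diff_count (cover (S :\ A)) (cover (S :\ A)) g)%N.
  by rewrite cBA; nia.
rewrite !(diff_count_coverl _ _ tSA) -big_split /= mulnC -cSA -sum_nat_const.
apply: leq_sum => C /setD1P[CA CS].
rewrite -(SEDF_diff_count CS g0) diff_count_coverr //.
rewrite (big_setD1 A) ?inE ?AS 1?eq_sym ?CA //= leq_add2l.
(* The differences within [C] itself are discarded here, hence only an inequality. *)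
rewrite [leqRHS](big_setD1 C) ?inE ?CA //= setDDl setUC -setDDl; exact: leq_addl.
Qed.

Lemma SEDF_bound : (0 < m)%N ->
  (k * (k - 1) * (l * (m - 2)) <= k * ((m - 1) * k) * (l - 1))%N.
Proof.
move=> m0; have [A AS] : exists A, A \in S.
  by apply/set0Pn; rewrite -card_gt0 (SEDF_card sedf).
have cA := SEDF_block sedf AS.
have := diff_count_quadruples A (cover (S :\ A)).
rewrite (eq_bigr (fun=> #|cover (S :\ A)| * l)%N) => [|x xA]; last first.
  rewrite -sum_nat_const; apply: eq_bigr => y yB.
  rewrite diff_count_coverr ?SEDF_trivIsetD1 // SEDF_diff_count //.
  exact: SEDF_disjoint_others yB.
rewrite sum_nat_const SEDF_card_others // cA mulnA => quad.
(* Passing from [l] to [l - 1] removes exactly the quadruples with [x = x']. *)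
rewrite [leqRHS]mulnBr muln1 quad addKn.
rewrite -mulnA -{1}cA -sum_nat_const; apply: leq_sum => x xA.
have -> : (k - 1)%N = #|A :\ x| by rewrite -cA (cardsD1 x A) xA addKn.
rewrite -sum_nat_const; apply: leq_sum => x' /setD1P[x'x _].
by apply: SEDF_diff_count_others; rewrite // subr_eq0 eq_sym.
Qed.

End SEDF.

Theorem theorem3p5 (n m k l : nat) (hl : (2 <= l)%N)
    (hex : exists (G : finZmodType) (S : {set {set G}}), is_SEDF n m k l S)
    (hm : (3 <= m)%N) (hk : (l + 1 <= k)%N) :
  (l%:R * (k%:R - 1) * (m%:R - 2)) / ((l%:R - 1) * k%:R * (m%:R - 1))
    <= 1 :> rat.
Proof.
have [G [S sedf]] := hex.
have bound : (l * (k - 1) * (m - 2) <= (l - 1) * k * (m - 1))%N.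
  have k0 : (0 < k)%N by lia.
  (* Both sides of [SEDF_bound] carry a common factor [k]. *)
  rewrite -(leq_pmul2l k0).
  have := SEDF_bound sedf (ltnW (ltnW hm)).
  by congr (_ <= _)%N; lia.
have pos : ((0 : rat) < (l - 1)%:R * k%:R * (m - 1)%:R)%R.
  by rewrite -!natrM ltr0n !muln_gt0; lia.
move: bound; rewrite -(ler_nat rat) !natrM.
(* By the bounds on [l], [m] and [k], no natural subtraction truncates, so each agrees with the one
   in [rat]. *)
move: pos; rewrite !natrB; try lia.
by move=> pos; rewrite ler_pdivrMr // mul1r.
Qed.
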